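(* Let $G$ be a finite group with commutator subgroup $G'$. Then $\mathcal{H}(G) \cap \mathbb{Z} = |G'|\,\mathbb{Z}$.
   Context: Let $A=\mathbb{Q}[G]$, with central primitive idempotents $e_1,\dots,e_t$, so $A=\bigoplus_i A_i$, $A_i=Ae_i\cong M_{n_i}(D_i)$ with $D_i$ a skewfield with centre $F_i$ and Schur index $s_i$ (so $[D_i:F_i]=s_i^2$). For $H\in M_n(A)$ write $H=\sum_i H_i$ with $H_i=He_i\in M_n(A_i)$, let $f_{H_i}(X)=\sum_{j=0}^{m_i}\alpha_{ij}X^j\in F_i[X]$ be the reduced characteristic polynomial of $H_i$, where $m_i=n_is_in$, and set $H_i^{\ast}:=(-1)^{m_i+1}\sum_{j=1}^{m_i}\alpha_{ij}H_i^{j-1}$ and $H^{\ast}:=\sum_i H_i^{\ast}\in M_n(A)$ (the generalised adjoint; it satisfies $HH^\ast=H^\ast H=\mathrm{nr}(H)\mathbf{1}_{n\times n}$, where $\mathrm{nr}$ is the reduced norm). The denominator ideal of $\mathbb{Z}[G]$ is $\mathcal{H}(G):=\{x\in\zeta(\mathbb{Z}[G]) : xH^{\ast}\in M_n(\mathbb{Z}[G]) \text{ for all } H\in M_n(\mathbb{Z}[G]) \text{ and all } n\in\mathbb{N}\}$, where $\zeta(\cdot)$ denotes the centre. *)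

(* Defs.v *)
From HB Require Import structures.
From mathcomp Require Import all_boot all_order all_algebra all_fingroup all_solvable all_field all_character.
Set Implicit Arguments. Unset Strict Implicit. Unset Printing Implicit Defensive.
Import Order.TTheory GRing.Theory Num.Theory.
Local Open Scope ring_scope.

(* Group algebra elements of C[G] (G = the whole finGroupType gT), with
   coefficients in algC.  Q[G] and Z[G] are the subsets of rational-valued
   (resp. integer-valued) functions. *)
Section GroupAlgebra.
Variable gT : finGroupType.

Definition grp_elt := gT -> algC.

Definition ga_mul (a b : grp_elt) : grp_elt :=
  fun g => \sum_(h : gT) a h * b (h^-1 * g)%g.

Definition ga_int (z : int) : grp_elt := fun g => z%:~R * (g == 1%g)%:R.

Definition in_ZG (a : grp_elt) : Prop := forall g, a g \is a Num.int.

Definition in_center_ZG (x : grp_elt) : Prop :=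
  in_ZG x /\ forall b : grp_elt, in_ZG b -> ga_mul x b = ga_mul b x.

Definition gmx (n : nat) := 'I_n -> 'I_n -> grp_elt.

Definition in_MZG n (H : gmx n) : Prop := forall i j, in_ZG (H i j).

Definition irr_deg (k : Iirr [set: gT]) : nat := irr_degree (socle_of_Iirr k).

Definition rep_elt (k : Iirr [set: gT]) (a : grp_elt) : 'M[algC]_(irr_deg k) :=
  \sum_(g : gT) a g *: 'Chi_k g.

(* image of H in M_n(M_{chi_k(1)}(C)) = M_{n chi_k(1)}(C), as a block matrix *)
Definition rep_mx (k : Iirr [set: gT]) n (H : gmx n) :=
  \mxblock_(i < n, j < n) rep_elt k (H i j) :
  'M_(\sum_(i < n) irr_deg k, \sum_(j < n) irr_deg k).

Definition adj_formula m (M : 'M[algC]_m) : 'M[algC]_m :=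
  (-1) ^+ m.+1 *: \sum_(j < m) (char_poly M)`_j.+1 *: M ^+ j.

Definition genadj_comp (k : Iirr [set: gT]) n (H : gmx n) :=
  adj_formula (rep_mx k H).

(* The generalised adjoint H^* in M_n(C[G]), recovered from its components
   via Fourier inversion on C[G] = prod_chi M_{chi(1)}(C):
     a(g) = 1/|G| sum_chi chi(1) tr(rho_chi(g^-1) rho_chi(a)). *)
Definition genadj n (H : gmx n) : gmx n :=
  fun i j g => (#|[set: gT]|%:R)^-1 *
    \sum_(k : Iirr [set: gT]) 'chi_k 1%g *
      \tr ('Chi_k (g^-1)%g *m submxblock (genadj_comp k H) i j).

Definition denom_ideal (x : grp_elt) : Prop :=
  in_center_ZG x /\
  forall (n : nat) (H : gmx n), in_MZG H ->
    in_MZG (fun i j => ga_mul x (genadj H i j)).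

End GroupAlgebra.

(* Main.v *)
Require Import Defs.
From HB Require Import structures.
From mathcomp Require Import all_boot all_order all_algebra all_fingroup all_solvable all_field all_character.
From mathcomp Require Import mpoly ring.
From Stdlib Require Import FunctionalExtensionality.
Set Implicit Arguments. Unset Strict Implicit. Unset Printing Implicit Defensive.
Import Order.TTheory GRing.Theory Num.Theory.
Local Open Scope ring_scope.

(** For [H = 0] and [n = 1] the generalised adjoint is the sum of the idempotents
    of the linear characters, whose coefficient at [1] is [1 / |G'|]; hence every
    integer of the denominator ideal is divisible by [|G'|].

    Conversely, by definition of the adjoint, a coefficient of [|G'| H^*] is
    [|G : G'|^-1] times the sum over the irreducible [chi] of
    [+- chi(1) sum_e c_(e+1)(chi) chi(x_e)], where the [x_e] are in [Z[G]] and
    [c_e(chi)] are the coefficients of the characteristic polynomial of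
    [rho_chi(H)].  Sum over the orbit of [chi] under twisting by the group
    [Lin(G)] of linear characters, which has order [|G : G'|].
    - As a function of [lambda] in [Lin(G)], [c_e(lambda chi)] is a combination
      of evaluations [lambda(y)], [y] in [G], with algebraic integers as
      coefficients; so averaging over [Lin(G)] stays integral.
    - The remaining denominator is the order of the stabiliser [S] of [chi], and
      [chi(1) chi(x) / |S|] is an algebraic integer by Clifford theory for the
      common kernel of [S].
    So the coefficient is an algebraic integer, and it is rational by Galois
    invariance. *)

(** * Rational numbers and algebraic integers in [algC] *)

Lemma fixed_by_aut_Crat (x : algC) :
  (forall nu : {rmorphism algC -> algC}, nu x = x) -> x \in Crat.
Proof.
move=> nux; have [p [Dp mon_p] dv_p] := minCpolyP x.
have [r Dr] := closed_field_poly_normal (map_poly ratr p : {poly algC}).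
rewrite lead_coef_map (monicP mon_p) rmorph1 scale1r in Dr.
have rx : x \in r by rewrite -root_prod_XsubC -Dr dv_p.
have [Qr [QrC [rr Drr genQr]]] := num_field_exists r.
have [y Dy]: exists y, QrC y = x.
  by move: rx; rewrite -Drr => /mapP[y _ ->]; exists y.
have Dp1 : map_poly (in_alg Qr) p = \prod_(z <- rr) ('X - z%:P).
  apply: (map_poly_inj QrC); rewrite -map_poly_comp rmorph_prod /=.
  rewrite -[LHS](@eq_map_poly _ _ (ratr : rat -> algC)) => [|a]; last first.
    by rewrite /= rmorphZ_num rmorph1 mulr1.
  rewrite Dr -Drr big_map; apply: eq_bigr => z _.
  by rewrite rmorphB /= map_polyX map_polyC.
(* Being generated by the roots of [p], the field [Qr] is a splitting field of [p], hence Galois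
   over the rationals. *)
have Qr_ax : FieldExt_isSplittingField _ Qr.
  constructor; exists (map_poly (in_alg Qr) p).
    by apply/polyOverP=> i; rewrite coef_map /= memvZ ?mem1v.
  by exists rr => //; rewrite Dp1 eqpxx.
pose Q := HB.pack_for (splittingFieldType rat) Qr Qr_ax.
have galQ : galois 1 {:Q}.
  rewrite /galois sub1v normalFieldf andbT /=.
  by apply/separableP => z _; apply: pcharf0_separable => q; rewrite -(fmorph_pchar QrC) pchar_num.
(* Every element of the Galois group extends to an automorphism of [algC], so it fixes [y]. *)
have /vlineP[a Da] : (y : Q) \in 1%VS.
  have /galois_fixedField <- := galQ.
  apply/fixedFieldP; rewrite ?memvf // => nu _.
  have [nuC DnuC] := extend_algC_subfield_aut (QrC : {rmorphism Q -> algC}) nu.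
  by apply: (fmorph_inj QrC); rewrite DnuC /= Dy nux.
by rewrite -Dy Da alg_num_field fmorph_rat; apply: Crat_rat.
Qed.

(** Transitivity of integrality: each coefficient is a root of its own minimal polynomial, which is
    monic and integral. *)
Lemma root_monic_over_Aint (p : {poly algC}) (x : algC) :
  p \is monic -> p \is a polyOver Aint -> root p x -> x \in Aint.
Proof.
move=> mon_p /polyOverP Zp px0.
have: integralOver (intr : int -> algC) x.
  apply: (integral_root_monic mon_p px0) => y /(nthP 0)[i _ <-].
  have /floorpP[q Dq] := Zp i.
  exists q; last by rewrite -Dq root_minCpoly.
  have: map_poly intr q \is @monic algC by rewrite -Dq minCpoly_monic.
  rewrite !monicE lead_coef_map_inj ?rmorph0 //; last exact: intr_inj.
  by rewrite -(rmorph1 (intr : int -> algC)) (inj_eq intr_inj).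
case=> q mon_q qx0; apply: (root_monic_Aint qx0).
  by rewrite monic_map.
by apply/polyOverP=> i; rewrite coef_map /= intr_int.
Qed.

(** [mu] is an eigenvalue of the matrix of [r]; the entries of the eigenvector [w] may be
    arbitrary. *)
Lemma Aint_eigen (T : finType) (r : T -> T -> algC) (w : T -> algC) (mu : algC) :
    (forall s t, r s t \in Aint) -> (exists t, w t != 0) ->
    (forall s, mu * w s = \sum_t r s t * w t) ->
  mu \in Aint.
Proof.
move=> Zr [t0 nz_w] Dmu.
(* Transposed, because [eigenvalue] is about row vectors. *)
pose A : 'M[algC]_#|T| := \matrix_(i, j) r (enum_val j) (enum_val i).
apply: (@root_monic_over_Aint (char_poly A)); first exact: char_poly_monic.
  apply/polyOverP=> i; suff: char_poly A \is a polyOver Aint by move/polyOverP.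
  apply: rpred_sum => s _; rewrite rpredMsign.
  apply: rpred_prod => j _; rewrite !mxE rpredB ?polyOverC ?Zr //.
  by rewrite rpredMn ?polyOverX.
rewrite -eigenvalue_root_char; apply/eigenvalueP.
exists (\row_i w (enum_val i)).
  apply/rowP=> j; rewrite !mxE Dmu.
  rewrite (reindex (@enum_val T T)) /=; last first.
    by apply: onW_bij; apply: enum_val_bij.
  by apply: eq_bigr => i _; rewrite !mxE mulrC.
apply: contraNneq nz_w => /rowP/(_ (enum_rank t0)).
by rewrite !mxE enum_rankK => ->.
Qed.

Lemma Aint_char_poly n (A : 'M[algC]_n) :
    (forall mu, eigenvalue A mu -> mu \in Aint) ->
  char_poly A \is a polyOver Aint.
Proof.
move=> ZA; have [r Dr] := closed_field_poly_normal (char_poly A).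
rewrite (monicP (char_poly_monic A)) scale1r in Dr.
rewrite Dr big_seq rpred_prod // => z rz.
by rewrite polyOverXsubC ZA // eigenvalue_root_char Dr root_prod_XsubC.
Qed.

(** * Coefficients of polynomials with integral values *)

Lemma sum_expr_unity_root N (x : algC) :
  x ^+ N = 1 -> \sum_(i < N) x ^+ i = if x == 1 then N%:R else 0.
Proof.
move=> xN1; case: eqP => [->|/eqP nx1].
  by under eq_bigr do rewrite expr1n; rewrite sumr_const card_ord.
apply: (@mulfI _ (x - 1)); first by rewrite subr_eq0.
by rewrite -subrX1 xN1 subrr mulr0.
Qed.

Section IntegralMPoly.

Variables (n : nat) (p : {mpoly algC[n]}).
Hypothesis Zp : forall v : 'I_n -> algC, (forall i, v i \in Aint) -> p.@[v] \in Aint.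

(* Orthogonality of the characters of [mu_N ^ n] extracts the coefficient. *)
Lemma Aint_mcoeff_muln N m :
  (msize p < N)%N -> m \in msupp p -> N%:R ^+ n * p@_m \in Aint.
Proof.
move=> lt_pN pm; have N_gt0 : (0 < N)%N by apply: leq_ltn_trans lt_pN.
have lt_N m1 : m1 \in msupp p -> forall i, (m1 i < N)%N.
  move=> pm1 i; apply: leq_ltn_trans lt_pN; apply: ltnW.
  apply: leq_ltn_trans (msize_mdeg_lt pm1).
  by rewrite mdegE (bigD1 i) //= leq_addr.
have [w prim_w] := C_prim_root_exists N_gt0.
have nz_w : w != 0 by rewrite (prim_root_eq0 prim_w) -lt0n.
have ZwX (k : nat) : w ^+ k \in Aint by rewrite rpredX // (Aint_prim_root prim_w).
(* [N - m i] stands for the exponent [- m i]. Exponents in the support are below [N], so there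
   [x m1 i] is 1 only if [m1 i = m i]. *)
pose x m1 i := w ^+ m1 i * w ^+ (N - m i).
have xE m1 i : m1 \in msupp p -> (x m1 i == 1) = (m1 i == m i).
  move=> pm1; rewrite -(inj_eq (mulIf (expf_neq0 (m i) nz_w))) mul1r -mulrA -exprD.
  rewrite subnK; last exact/ltnW/lt_N.
  by rewrite (prim_expr_order prim_w) mulr1 (eq_prim_root_expr prim_w) !modn_small ?lt_N.
suff <- : \sum_(z : {ffun 'I_n -> 'I_N})
   (\prod_i w ^+ ((N - m i) * z i)) * p.@[fun i => w ^+ z i] = N%:R ^+ n * p@_m.
  apply: rpred_sum => z _; apply: rpredM; last by apply: Zp => i; apply: ZwX.
  by apply: rpred_prod => i _; apply: ZwX.
transitivity (\sum_(m1 <- msupp p) p@_m1 * \prod_i \sum_(j < N) x m1 i ^+ j).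
  under eq_bigr do rewrite mevalE mulr_sumr.
  rewrite exchange_big /=; apply: eq_bigr => m1 _.
  rewrite bigA_distr_bigA mulr_sumr; apply: eq_bigr => z _.
  rewrite mulrCA -big_split /=; congr (_ * _); apply: eq_bigr => i _.
  by rewrite exprMn -!exprM mulrC [(z i * _)%N]mulnC.
rewrite (bigD1_seq m) //=.
rewrite [X in _ + X]big1_seq ?addr0 => [|m1 /andP[nm1 pm1]].
  rewrite mulrC; congr (_ * _).
  rewrite -[n in RHS]card_ord -prodr_const; apply: eq_bigr => i _.
  rewrite sum_expr_unity_root ?xE ?eqxx //.
  by rewrite exprMn -!exprM ![(_ * N)%N]mulnC !exprM !(prim_expr_order prim_w) !expr1n mulr1.
have [i nm1i] : exists i, m1 i != m i.
  apply/existsP; apply: contraR nm1; rewrite negb_exists => /forallP eqm.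
  by apply/eqP/mnmP => i; apply/eqP; rewrite -[_ == _]negbK eqm.
rewrite (bigD1 i) //= sum_expr_unity_root ?xE ?(negPf nm1i) ?mul0r ?mulr0 //.
by rewrite exprMn -!exprM ![(_ * N)%N]mulnC !exprM !(prim_expr_order prim_w) !expr1n mulr1.
Qed.

(* Clear the powers of two coprime orders [N] and [N + 1]. *)
Lemma Aint_mcoeff m : p@_m \in Aint.
Proof.
have [pm | /memN_msupp_eq0->//] := boolP (m \in msupp p).
pose N := (msize p).+1.
have [u [v]] : exists u v : int, u * (N ^ n)%N%:Z + v * (N.+1 ^ n)%N%:Z = 1.
  have : coprime (N ^ n) (N.+1 ^ n) by rewrite coprimeXl ?coprimeXr ?coprimenS.
  case/(@coprimezP (N ^ n)%N%:Z (N.+1 ^ n)%N%:Z) => [[u v]] /=.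
  by exists u, v.
move=> /(congr1 (fun y : int => y%:~R * p@_m)).
rewrite rmorphD !rmorphM /= mul1r => <-.
rewrite mulrDl -!mulrA -!pmulrn !natrX.
by rewrite rpredD // rpredM ?Aint_int // Aint_mcoeff_muln.
Qed.

End IntegralMPoly.

(** * Groups of linear characters and Clifford theory *)

Section LinearCharacterGroup.

Variables (gT L : finGroupType) (G : {group gT}) (cF : L -> 'CF(G)).
Hypotheses (cF_lin : forall u, cF u \is a linear_char) (cF_inj : injective cF).
Hypotheses (cF1 : cF 1%g = 1) (cFM : {morph cF : u v / (u * v)%g >-> u * v}).

Lemma sum_lin_char_elt u : \sum_(g in G) cF u g = #|G|%:R * (u == 1%g)%:R.
Proof.
have /irrP[i Di] := lin_char_irr (cF_lin u).
have /irrP[j Dj] := lin_char_irr (cF_lin 1%g).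
have := cfdot_irr i j; rewrite cfdotE => /(canRL (mulVKf (neq0CG G))).
rewrite -(inj_eq irr_inj) -Di -Dj (inj_eq cF_inj) => <-.
by apply: eq_bigr => g Gg; rewrite cF1 cfun1E Gg rmorph1 mulr1.
Qed.

(** Translating [S] by some [u0] in [S] with [cF u0 g != 1] multiplies the sum by [cF u0 g], which
    forces it to vanish. *)
Lemma sum_lin_char_group (S : {group L}) g : g \in G ->
  \sum_(u in S) cF u g = if [forall u in S, cF u g == 1] then #|S|%:R else 0.
Proof.
move=> Gg; case: ifPn => [/forall_inP cFg1|].
  by rewrite (eq_bigr (fun=> 1)) ?sumr_const // => u /cFg1/eqP.
case/forall_inPn => u0 Su0 nt_u0; set s := \sum_(u in S) _.
apply: (@mulfI _ (cF u0 g - 1)); first by rewrite subr_eq0.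
rewrite mulr0 mulrBl mul1r; apply/eqP; rewrite subr_eq0; apply/eqP.
rewrite [RHS](reindex_inj (mulgI u0)) mulr_sumr /=.
apply: eq_big => [u|u _]; first by rewrite groupMl.
by rewrite cFM cfunE.
Qed.

(* Let [K] be the common kernel of [S], so that [#|G : K| = #|S|] and ['chi_k]
   vanishes off [K].  If [e] is the ramification index and [r] the number of
   constituents of ['Res[K] 'chi_k], then [e ^ 2 * r = #|S|], while the degree
   and the values of ['chi_k] contribute the factors [e * r] and [e]. *)
Lemma Aint_irr_div_stab (S : {group L}) (k : Iirr G) :
    (forall u, u \in S -> cF u * 'chi_k = 'chi_k) ->
  forall g, 'chi_k 1%g * 'chi_k g / #|S|%:R \in Aint.
Proof.
move=> stabS.
pose K : {group gT} := (G :&: \bigcap_(u in S) cfker (cF u))%G.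
have KP g : g \in G -> (g \in K) = [forall u in S, cF u g == 1].
  move=> Gg; rewrite inE Gg /=; apply/bigcapP/forall_inP => cFg u Su.
    by have:= cFg u Su; rewrite cfkerEchar ?lin_charW // inE lin_char1 // => /andP[].
  by rewrite cfkerEchar ?lin_charW // inE Gg lin_char1 ?cFg.
have nsKG : (K <| G)%g.
  rewrite /normal subsetIl normsI ?normG //; apply: norms_bigcap.
  by apply/bigcapsP => u _; apply: normal_norm (cfker_normal _).
have chiK0 g : g \notin K -> 'chi_k g = 0.
  move=> notKg; have [Gg | /cfun0->//] := boolP (g \in G).
  move: notKg; rewrite KP // => /forall_inPn[u Su nt_u].
  have := congr1 (fun phi : 'CF(G) => phi g) (stabS u Su).
  rewrite cfunE => /eqP; rewrite -subr_eq0 -{2}['chi_k g]mul1r -mulrBl mulf_eq0.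
  by rewrite subr_eq0 (negPf nt_u) => /eqP.
(* The double sum is computed in two ways: summed over [S] first, it is [#|S|] on [K] and 0
   elsewhere; summed over [G] first, only [u = 1] survives. *)
have oS : #|S|%:R * #|K|%:R = #|G|%:R :> algC.
  transitivity (\sum_(g in G) \sum_(u in S) cF u g).
    rewrite (eq_bigr (fun g => if g \in K then #|S|%:R else 0)) => [|g Gg].
      rewrite -big_mkcondr /= (eq_bigl (fun g => g \in K)) => [|g].
        by rewrite sumr_const mulr_natr.
      by rewrite andb_idl // => /setIP[].
    by rewrite sum_lin_char_group // KP.
  rewrite exchange_big (bigD1 1%g) //= sum_lin_char_elt eqxx mulr1 big1 ?addr0 //.
  by move=> u /andP[_ /negPf nt_u]; rewrite sum_lin_char_elt nt_u mulr0.
(* As ['chi_k] is supported on [K], its norm over [K] is [#|G : K|] times its norm over [G]. *)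
have normK : '['Res[K] 'chi_k] = #|S|%:R.
  apply: (mulfI (neq0CG K)); rewrite [RHS]mulrC oS.
  transitivity (#|G|%:R * '['chi_k]); last by rewrite cfnorm_irr mulr1.
  rewrite !cfdotE !mulVKf ?neq0CG // [RHS](bigID (fun g => g \in K)) /=.
  rewrite [X in _ + X]big1 => [|g /andP[_ /chiK0->]]; last by rewrite mul0r.
  rewrite addr0; apply: eq_big => [g|g Kg].
    by rewrite andb_idl // => /(subsetP (normal_sub nsKG)).
  by rewrite !cfResE ?normal_sub.
have [j Kj] := constt_cfRes_irr K k.
have Dres := Clifford_Res_sum_cfclass nsKG Kj.
have Ne : '['Res[K] 'chi_k, 'chi_j] \in Num.nat.
  by rewrite Cnat_cfdot_char ?cfRes_char ?irr_char.
set e := '[_, _] in Dres Ne; set cls := ('chi_j ^: G)%CF in Dres.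
have irr_cls xi : xi \in cls -> xi \in irr K.
  by case/cfclassP => y _ ->; rewrite cfConjg_irr ?mem_irr.
have oncls : orthonormal cls.
  by apply: sub_orthonormal (irr_orthonormal K); rewrite ?cfclass_uniq.
have eS : e * e * (size cls)%:R = #|S|%:R.
  rewrite -normK Dres cfnormZ cfnorm_orthonormal // normCK.
  by rewrite (conj_natr Ne).
have chiE g : g \in K -> 'chi_k g = e * \sum_(xi <- cls) xi g.
  by move=> Kg; rewrite -(cfResE _ (normal_sub nsKG)) // Dres cfunE sum_cfunE.
have chi1 : 'chi_k 1%g = e * ((size cls)%:R * 'chi_j 1%g).
  rewrite chiE //; congr (_ * _); rewrite (eq_big_seq (fun=> 'chi_j 1%g)) => [|xi].
    by rewrite big_const_seq count_predT iter_addr_0 mulr_natl.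
  by case/cfclassP => y _ ->; apply: cfConjg1.
move=> g; have [Kg | /chiK0->] := boolP (g \in K); last by rewrite mulr0 mul0r.
rewrite chi1 chiE //.
have -> : e * ((size cls)%:R * 'chi_j 1%g) * (e * \sum_(xi <- cls) xi g)
    = 'chi_j 1%g * (\sum_(xi <- cls) xi g) * #|S|%:R.
  by rewrite -eS; ring.
rewrite mulfK ?neq0CG // rpredM ?Aint_irr // big_seq rpred_sum // => xi /irr_cls.
by case/irrP => i ->; apply: Aint_irr.
Qed.

End LinearCharacterGroup.

(** * Matrices over the group algebra and their images under representations *)

Lemma char_poly_conj (F : fieldType) m (P A B : 'M[F]_m) :
  P \in unitmx -> P *m A = B *m P -> char_poly A = char_poly B.
Proof.
move=> uP PA; pose Pp := map_mx polyC P.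
have : Pp *m char_poly_mx A = char_poly_mx B *m Pp.
  rewrite /char_poly_mx mulmxBr mulmxBl -scalar_mxC; congr (_ - _).
  by rewrite /Pp -!map_mxM PA.
move/(congr1 determinant); rewrite !det_mulmx [RHS]mulrC.
apply: mulfI; rewrite det_map_mx polyC_eq0 -unitfE; exact: uP.
Qed.

Section RepresentationMatrices.

Variable gT : finGroupType.
Local Notation G := [set: gT]%G.
Implicit Types (a b : grp_elt gT) (n d : nat).

Definition gmx_one n : gmx gT n := fun i j g => (i == j)%:R * (g == 1%g)%:R.

Definition gmx_mul n (H1 H2 : gmx gT n) : gmx gT n :=
  fun i j g => \sum_l ga_mul (H1 i l) (H2 l j) g.

Definition gmx_exp n (H : gmx gT n) e : gmx gT n := iter e (gmx_mul H) (@gmx_one n).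

(** Twisting needs only linear characters [v]; with arbitrary [v] the values [v g] can serve as
    independent variables. *)
Definition gmx_scale n (v : gT -> algC) (H : gmx gT n) : gmx gT n :=
  fun i j g => v g * H i j g.

Definition gmx_Aint n (H : gmx gT n) := forall i j g, H i j g \in Aint.

Lemma gmx_exp_int n (H : gmx gT n) e : in_MZG H -> in_MZG (gmx_exp H e).
Proof.
move=> ZH; elim: e => [|e IHe] i j g; first by rewrite rpredM ?rpred_nat.
by rewrite rpred_sum // => l _; rewrite rpred_sum // => h _; rewrite rpredM ?ZH ?IHe.
Qed.

Definition repr_elt d (rG : mx_representation algC G d) a : 'M[algC]_d :=
  \sum_(g : gT) a g *: rG g.

Definition repr_block d (rG : mx_representation algC G d) n (H : gmx gT n) :=
  \mxblock_(i < n, j < n) repr_elt rG (H i j) :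
  'M_(\sum_(i < n) d, \sum_(j < n) d).

Section OneRepresentation.

Variables (d : nat) (rG : mx_representation algC G d).

Lemma repr_setTM x y : rG (x * y)%g = rG x *m rG y.
Proof. by rewrite repr_mxM ?inE. Qed.

Lemma repr_elt_mul a b : repr_elt rG (ga_mul a b) = repr_elt rG a *m repr_elt rG b.
Proof.
rewrite /repr_elt mulmx_suml.
under [RHS]eq_bigr => h _.
  rewrite mulmx_sumr (reindex_inj (mulgI h^-1)%g) /=.
  under eq_bigr => g _ do
    rewrite -scalemxAl -scalemxAr -repr_setTM mulKVg scalerA.
  over.
rewrite exchange_big; apply: eq_bigr => g _ /=.
by rewrite /ga_mul scaler_suml.
Qed.

Lemma repr_elt_sum (I : finType) (a : I -> grp_elt gT) :
  repr_elt rG (fun g => \sum_i a i g) = \sum_i repr_elt rG (a i).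
Proof.
rewrite /repr_elt exchange_big /=; apply: eq_bigr => g _.
by rewrite scaler_suml.
Qed.

(** Powers are formed before applying [rG], so that the entries of [H ^ e] are the same for all
    representations. *)
Lemma repr_block_exp n (H : gmx gT n) e :
  repr_block rG (gmx_exp H e) = repr_block rG H ^+ e.
Proof.
elim: e => [|e IHe].
  rewrite expr0 -[RHS](mxdiagZ (p_ := fun=> d)); apply: eq_mxblock => i j.
  rewrite /repr_elt (bigD1 1%g) //= big1 => [|g /negPf ng]; last first.
    by rewrite /gmx_one ng mulr0 scale0r.
  rewrite addr0 /gmx_one eqxx mulr1 repr_mx1 conform_mx_id.
  by case: eqP => _; rewrite ?scale1r ?scale0r.
rewrite exprS -IHe [RHS]mul_mxblock; apply: eq_mxblock => i j.
by rewrite /= repr_elt_sum; apply: eq_bigr => l _; rewrite repr_elt_mul.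
Qed.

(** For an eigenvector with blocks [v_ i], the rows [v_ i *m rG h] satisfy a linear system with
    eigenvalue [mu] whose coefficients are coefficients of [H], whatever the entries of [rG]. *)
Lemma Aint_char_poly_repr_block n (H : gmx gT n) :
  gmx_Aint H -> char_poly (repr_block rG H) \is a polyOver Aint.
Proof.
move=> ZH; apply: Aint_char_poly => mu /eigenvalueP[v Dv nz_v].
pose v_ i : 'rV[algC]_d := submxrow v i.
have Dv_ j : \sum_i v_ i *m repr_elt rG (H i j) = mu *: v_ j.
  have := congr1 (fun w => submxrow w j) Dv.
  rewrite -{1}[v]submxrowK mul_mxrow_mxblock mxrowK => ->.
  by apply/matrixP => s t; rewrite !mxE.
have /existsP[j /existsP[c nz_vjc]] : [exists j, exists c, v_ j 0 c != 0].
  apply: contraR nz_v; rewrite negb_exists => /forallP v0.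
  apply/eqP/mxrowP => j; apply/rowP => c; rewrite submxrow0 [RHS]mxE.
  by have := v0 j; rewrite negb_exists => /forallP/(_ c); rewrite negbK => /eqP.
pose w (t : 'I_n * gT) := (v_ t.1 *m rG t.2) 0 c.
pose r (s t : 'I_n * gT) := H t.1 s.1 (t.2 * s.2^-1)%g.
apply: (@Aint_eigen _ r w); first by move=> s t; apply: ZH.
  by exists (j, 1%g); rewrite /w repr_mx1 mulmx1.
move=> [l g]; rewrite /w /r /=.
have -> : mu * (v_ l *m rG g) 0 c = ((mu *: v_ l) *m rG g) 0 c.
  by rewrite -scalemxAl [RHS]mxE.
rewrite -Dv_ mulmx_suml summxE.
rewrite -(pair_bigA _ (fun i h => H i l (h * g^-1)%g * (v_ i *m rG h) 0 c)) /=.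
apply: eq_bigr => i _; rewrite mulmx_sumr mulmx_suml summxE.
rewrite [RHS](reindex_inj (mulIg g)); apply: eq_bigr => h _ /=.
by rewrite mulgK -scalemxAr -scalemxAl -mulmxA -repr_setTM [LHS]mxE.
Qed.

(** The matrix is a specialisation of a generic one, with one variable per group element, and
    characteristic polynomials commute with evaluation. *)
Lemma char_poly_repr_block_mpoly n (H : gmx gT n) j :
  exists p : {mpoly algC[#|gT|]}, forall v : gT -> algC,
    (char_poly (repr_block rG (gmx_scale v H)))`_j = p.@[fun i => v (enum_val i)].
Proof.
pose Mg (g : gT) := (\mxblock_(a < n, b < n) (H a b g *: rG g)
  : 'M[algC]_(\sum_(i < n) d, \sum_(j < n) d)).
pose X := \sum_(g : gT) ('X_(enum_rank g) : {mpoly algC[#|gT|]}) *: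
   map_mx (@mpolyC #|gT| algC) (Mg g).
exists (char_poly X)`_j => v.
rewrite -coef_map map_char_poly; congr ((char_poly _)`_j).
rewrite map_mx_sum.
apply/matrixP => s t; rewrite mxE !summxE; apply: eq_bigr => g _.
by rewrite !mxE /= mevalM mevalXU mevalC enum_rankK mulrA.
Qed.

(* The entries of [rG] need not be algebraic integers, so integrality of the
   coefficients is obtained from the integrality of the values at all points. *)
Lemma char_poly_repr_block_twist n (H : gmx gT n) j : gmx_Aint H ->
  exists2 s : seq (algC * gT), (forall p, p \in s -> p.1 \in Aint) &
  forall phi : 'CF(G), phi \is a linear_char ->
    (char_poly (repr_block rG (gmx_scale phi H)))`_j = \sum_(p <- s) p.1 * phi p.2.
Proof.
move=> ZH; have [p Dp] := char_poly_repr_block_mpoly H j.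
have Zp v : (forall i, v i \in Aint) -> p.@[v] \in Aint.
  move=> Zv; pose v' g := v (enum_rank g).
  have -> : p.@[v] = p.@[fun i => v' (enum_val i)].
    by apply: meval_eq => i; rewrite /v' enum_valK.
  rewrite -Dp; move: (j); apply/polyOverP; apply: Aint_char_poly_repr_block.
  by move=> i l g; apply: rpredM; [apply: Zv | apply: ZH].
(* By multiplicativity, a monomial in the values of [phi] is the value of [phi] at a single product
   of group elements. *)
exists [seq (p@_m, (\prod_i enum_val i ^+ m i)%g) | m <- msupp p] => [q|phi lin_phi].
  by case/mapP => m _ ->; apply: Aint_mcoeff.
rewrite Dp mevalE [RHS]big_map; apply: eq_bigr => m _ /=; congr (_ * _).
rewrite lin_char_prod ?inE // => [|i _]; last by rewrite inE.
by apply: eq_bigr => i _; rewrite lin_charX ?inE.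
Qed.

End OneRepresentation.

(** * Coefficients of the generalised adjoint *)

Section AdjCoef.

Variables (n : nat) (H : gmx gT n) (i l : 'I_n) (g : gT).

(* The contribution of [rG] to the coefficient at [g] of the entry [(i, l)] of
   [H^*], up to the factor [chi(1) / |G|]; see [genadjE]. *)
Definition adj_coef d (rG : mx_representation algC G d) : algC :=
  let m := (\sum_(i < n) d)%N in
  (-1) ^+ m.+1 * \sum_(e < m) (char_poly (repr_block rG H))`_e.+1 *
    \sum_h gmx_exp H e i l h * cfRepr rG (g^-1 * h)%g.

(** ['Chi_k] is a chosen representative; for a Galois conjugate or a twist of a character, this
    allows the explicit conjugate or twisted representation instead. *)
Lemma adj_coef_rsim d1 d2 (rG1 : mx_representation algC G d1)
    (rG2 : mx_representation algC G d2) :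
  cfRepr rG1 = cfRepr rG2 -> adj_coef rG1 = adj_coef rG2.
Proof.
move=> eqG; have [B d12 fB simB] := cfRepr_inj eqG.
move: rG2 B eqG fB simB; rewrite -{}d12 => rG2 B eqG fB simB.
rewrite /adj_coef -eqG.
suff -> : char_poly (repr_block rG1 H) = char_poly (repr_block rG2 H) by [].
rewrite row_free_unit in fB.
pose P := \mxdiag_(i < n) B : 'M_(\sum_(i < n) d1).
pose P' := \mxdiag_(i < n) invmx B : 'M_(\sum_(i < n) d1).
have PP' : P *m P' = 1%:M.
  rewrite /P' /mxdiag /P mul_mxdiag_mxblock -(mxdiagZ (p_ := fun=> d1)).
  apply: eq_mxblock => a b; case: eqP => _; last by rewrite mulmx0.
  by rewrite !conform_mx_id mulmxV.
apply/esym/(@char_poly_conj _ _ P); first by case/mulmx1_unit: PP'.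
rewrite mul_mxdiag_mxblock mul_mxblock_mxdiag; apply: eq_mxblock => a b.
rewrite mulmx_sumr mulmx_suml; apply: eq_bigr => h _.
by rewrite -scalemxAl -scalemxAr simB ?inE.
Qed.

Lemma mxtrace_adj_formula d (rG : mx_representation algC G d) :
  \tr (rG g^-1%g *m submxblock (adj_formula (repr_block rG H)) i l) = adj_coef rG.
Proof.
rewrite /adj_formula; set m := (\sum_(i < n) d)%N.
have -> (c : algC) A : submxblock (c *: A : 'M_m) i l = c *: submxblock A i l.
  by apply/matrixP => s t; rewrite !mxE.
rewrite -scalemxAr mxtraceZ submxblock_sum mulmx_sumr raddf_sum; congr (_ * _).
apply: eq_bigr => e _ /=.
have -> (c : algC) A : submxblock (c *: A : 'M_m) i l = c *: submxblock A i l.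
  by apply/matrixP => s t; rewrite !mxE.
rewrite -scalemxAr mxtraceZ -repr_block_exp mxblockK; congr (_ * _).
rewrite mulmx_sumr raddf_sum; apply: eq_bigr => h _ /=.
by rewrite -scalemxAr mxtraceZ -repr_setTM cfunE inE.
Qed.

End AdjCoef.

Lemma genadjE n (H : gmx gT n) i l g :
  genadj H i l g =
  #|gT|%:R^-1 * \sum_(k : Iirr G) 'chi_k 1%g * adj_coef H i l g 'Chi_k.
Proof.
rewrite /genadj cardsT; congr (_ * _); apply: eq_bigr => k _.
by rewrite -mxtrace_adj_formula.
Qed.

End RepresentationMatrices.

(** * Orbit sums and twists by linear characters *)

Lemma sum_orbit (R : pzRingType) (aT : finGroupType) (rT : finType)
    (to : {action aT &-> rT}) (A : {group aT}) (F : rT -> R) x :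
  \sum_(a in A) F (to x a) =
    #|('C_A[x | to])%g|%:R * \sum_(y in orbit to A x) F y.
Proof.
rewrite (partition_big (fun a => to x a) (fun y => y \in orbit to A x)) /=; last first.
  by move=> a Aa; apply: mem_orbit.
rewrite mulr_sumr; apply: eq_bigr => y /orbitP[a Aa <-].
rewrite (eq_bigr (fun=> F (to x a))) => [|b /andP[_ /eqP->]] //.
rewrite sumr_const mulr_natl; congr (_ *+ _).
(* The elements of [A] carrying [x] to [to x a] form a right coset of the stabiliser. *)
rewrite -(card_rcoset _ a) -(amove_act to x (subsetT A)) //.
by apply: eq_card => b; rewrite inE.
Qed.

Section Twist.

Variables (gT : finGroupType).
Local Notation G := [set: gT]%G.
Variables (phi : 'CF(G)) (lin_phi : phi \is a linear_char).
Variables (d : nat) (rG : mx_representation algC G d).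

Fact twist_repr_subproof : mx_repr G (fun g => phi g *: rG g).
Proof.
split=> [|x y Gx Gy]; first by rewrite lin_char1 // repr_mx1 scale1r.
by rewrite lin_charM // repr_mxM // -scalemxAl -scalemxAr scalerA.
Qed.
Definition twist_repr := MxRepresentation twist_repr_subproof.

Lemma cfRepr_twist : cfRepr twist_repr = phi * cfRepr rG.
Proof.
by apply/cfunP => g; rewrite !cfunE /= inE mxtraceZ.
Qed.

(** Moves [phi] from the representation into the matrix, where [char_poly_repr_block_twist]
    applies. *)
Lemma repr_block_twist n (H : gmx gT n) :
  repr_block twist_repr H = repr_block rG (gmx_scale phi H).
Proof.
apply: eq_mxblock => i j; apply: eq_bigr => g _ /=.
by rewrite scalerA mulrC.
Qed.

End Twist.

(** * Rationality and integrality of the coefficients *)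

Section IntegralityOfAdjoint.

Variables (gT : finGroupType) (n : nat) (H : gmx gT n).
Hypothesis ZH : in_MZG H.
Variables (i l : 'I_n) (g : gT).
Local Notation G := [set: gT]%G.
Local Notation T k := ('chi_k 1%g * adj_coef H i l g 'Chi_k).

(** An automorphism of [algC] fixes the entries of [H] and of its powers and permutes the
    irreducible characters, hence merely permutes the terms. *)
Lemma Crat_sum_adj_coef : \sum_(k : Iirr G) T k \in Crat.
Proof.
apply: fixed_by_aut_Crat => nu; rewrite rmorph_sum /=.
rewrite [RHS](reindex_inj (@aut_Iirr_inj _ _ nu)); apply: eq_bigr => k _.
rewrite rmorphM /= aut_IirrE cfunE; congr (_ * _).
rewrite -(@adj_coef_rsim _ _ H i l g _ _ (map_repr nu 'Chi_k) 'Chi_(aut_Iirr nu k)); last first.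
  by rewrite cfRepr_map !irrRepr aut_IirrE.
have nuH i1 l1 h e : nu (gmx_exp H e i1 l1 h) = gmx_exp H e i1 l1 h.
  by rewrite aut_intr // gmx_exp_int.
have nuM : map_mx nu (repr_block 'Chi_k H) = repr_block (map_repr nu 'Chi_k) H.
  apply/matrixP => s t; rewrite !mxE !summxE rmorph_sum; apply: eq_bigr => h _ /=.
  by rewrite !mxE rmorphM aut_intr ?ZH.
rewrite /adj_coef rmorphM rmorph_sign rmorph_sum /=; congr (_ * _).
apply: eq_bigr => e _; rewrite rmorphM -nuM -map_char_poly coef_map rmorph_sum /=.
congr (_ * _); apply: eq_bigr => h _.
by rewrite rmorphM /= nuH cfRepr_map [cfAut _ _ _]cfunE.
Qed.

Lemma Aint_sum_adj_coef : #|G : G^`(1)|%g%:R^-1 * \sum_(k : Iirr G) T k \in Aint.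
Proof.
have [L [cF [cF_inj oL cF_lin _] [cF1 cFM _ _ _]]] := lin_char_group G.
pose act (k : Iirr G) u := cfIirr (cF u * 'chi_k).
have actE k u : 'chi_(act k u) = cF u * 'chi_k.
  by rewrite cfIirrE // mul_lin_irr ?mem_irr.
have act1 : act^~ 1%g =1 id by move=> k; apply: irr_inj; rewrite actE cF1 mul1r.
have actM k : act_morph act k.
  by move=> u v; apply: irr_inj; rewrite !actE cFM mulrA [cF v * _]mulrC.
pose to := TotalAction act1 actM.
rewrite -oL.
have -> : \sum_(k : Iirr G) T k = \sum_(k in [set: Iirr G]) T k.
  by apply: eq_bigl => k; rewrite inE.
rewrite (partition_big_imset (orbit to [set: L])) mulr_sumr rpred_sum //= => O.
case/imsetP => k _ ->{O}.
rewrite (eq_bigl (fun j => j \in orbit to [set: L] k)) => [|j]; last first.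
  by rewrite inE /= orbit_eq_mem.
set S := ('C_[set: L][k | to])%G.
have nzS : #|S|%:R != 0 :> algC by rewrite pnatr_eq0 -lt0n cardG_gt0.
have -> : \sum_(j in orbit to [set: L] k) T j
    = #|S|%:R^-1 * \sum_(u in [set: L]) T (act k u).
  by rewrite (sum_orbit to [set: L]%G (fun j => T j)) mulKf.
have stabS u : u \in S -> cF u * 'chi_k = 'chi_k.
  by case/setIP => _ /astab1P Su; rewrite -actE; congr 'chi__.
set d := irr_degree (socle_of_Iirr k); set m := (\sum_(i < n) d)%N.
pose c e u := (char_poly (repr_block 'Chi_k (gmx_scale (cF u) H)))`_e.+1.
pose t e u := \sum_h gmx_exp H e i l h * (cF u (g^-1 * h)%g * 'chi_k (g^-1 * h)%g).
have TE u : T (act k u) =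
    'chi_k 1%g * ((-1) ^+ m.+1 * \sum_(e < m) c e u * t e u).
  rewrite actE cfunE lin_char1 // mul1r; congr (_ * _).
  rewrite (@adj_coef_rsim _ _ H i l g _ _ _ (twist_repr (cF_lin u) 'Chi_k)).
    rewrite /adj_coef repr_block_twist cfRepr_twist irrRepr; congr (_ * _).
    by apply: eq_bigr => e _; congr (_ * _); apply: eq_bigr => h _; rewrite cfunE.
  by rewrite cfRepr_twist !irrRepr actE.
have -> : #|L|%:R^-1 * (#|S|%:R^-1 * \sum_(u in [set: L]) T (act k u)) =
    (-1) ^+ m.+1 * \sum_(e < m)
      #|L|%:R^-1 * (#|S|%:R^-1 * \sum_(u in [set: L]) 'chi_k 1%g * (c e u * t e u)).
  under eq_bigr do rewrite TE !mulr_sumr.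
  rewrite exchange_big !mulr_sumr; apply: eq_bigr => e _ /=.
  rewrite !mulr_sumr; apply: eq_bigr => u _.
  by rewrite ['chi_k _ * _]mulrCA ![_ * ((-1) ^+ _ * _)]mulrCA.
rewrite rpredMsign rpred_sum // => e _.
have ZAH : gmx_Aint H by move=> i1 l1 h; apply/Aint_Cint/ZH.
have [s Zs Ds] := char_poly_repr_block_twist 'Chi_k e.+1 ZAH.
(* The factor [cF u p.2] from [c] and the factor [cF u (g^-1 * h)] from [t] merge into one value,
   averaged over [L]; the denominator [#|S|] goes with ['chi_k]. *)
have -> : #|L|%:R^-1 * (#|S|%:R^-1 *
      \sum_(u in [set: L]) 'chi_k 1%g * (c e u * t e u)) =
    \sum_(p <- s) \sum_h p.1 * gmx_exp H e i l h *
      ('chi_k 1%g * 'chi_k (g^-1 * h)%g / #|S|%:R) *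
      (#|L|%:R^-1 * \sum_(u in [set: L]) cF u (p.2 * (g^-1 * h))%g).
  rewrite !mulr_sumr (eq_bigr (fun u => \sum_(p <- s) \sum_h
    #|L|%:R^-1 * (#|S|%:R^-1 * ('chi_k 1%g * (p.1 * cF u p.2 *
      (gmx_exp H e i l h * (cF u (g^-1 * h)%g * 'chi_k (g^-1 * h)%g))))))) => [|u _]; last first.
    rewrite /c /t Ds // big_distrlr !mulr_sumr.
    by apply: eq_bigr => p _; rewrite !mulr_sumr.
  rewrite exchange_big; apply: eq_bigr => p _.
  rewrite exchange_big; apply: eq_bigr => h _.
  rewrite !mulr_sumr; apply: eq_bigr => u _.
  rewrite [cF u (p.2 * _)%g]lin_charM ?inE //.
  move: (cF u _) (cF u _) ('chi_k _) ('chi_k _) (gmx_exp _ _ _ _ _) p.1.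
  move: (#|L|%:R^-1) (#|S|%:R^-1) => b1 b2 a1 a2 a3 a4 a5 a6.
  by ring.
rewrite big_seq rpred_sum // => p /Zs Zp; rewrite rpred_sum // => h _.
apply: rpredM; first apply: rpredM; first apply: rpredM => //.
- by apply/Aint_Cint/gmx_exp_int.
- exact: Aint_irr_div_stab stabS _.
(* The average over [L] is 1 or 0. *)
rewrite (sum_lin_char_group cFM [set: L]%G) ?inE //; case: ifP => _.
  by rewrite cardsT mulVf // pnatr_eq0 -lt0n -cardsT cardG_gt0.
by rewrite mulr0.
Qed.

End IntegralityOfAdjoint.

Lemma genadj_int (gT : finGroupType) n (H : gmx gT n) i l g : in_MZG H ->
  #|([set: gT]^`(1))%g|%:R * genadj H i l g \is a Num.int.
Proof.
move=> ZH; pose G := [set: gT]%G.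
have -> : #|([set: gT]^`(1))%g|%:R * genadj H i l g =
    #|G : G^`(1)|%g%:R^-1 *
    \sum_(k : Iirr G) 'chi_k 1%g * adj_coef H i l g 'Chi_k.
  rewrite genadjE mulrA; congr (_ * _).
  rewrite -cardsT -(Lagrange (der_sub 1 G)) natrM invfM mulVKf //.
  by rewrite pnatr_eq0 -lt0n cardG_gt0.
apply: Cint_rat_Aint; last exact: Aint_sum_adj_coef.
by rewrite rpredM ?Crat_sum_adj_coef // rpredV rpred_nat.
Qed.

(** * The generalised adjoint of the zero matrix *)

Section ZeroMatrix.
Variable gT : finGroupType.
Local Notation G := [set: gT]%G.
Let H0 : gmx gT 1 := fun _ _ _ => 0.

(** The characteristic polynomial is [X ^ d], so only the power [d - 1] of the zero matrix enters;
    it is nonzero just for [d = 1], where it is the identity. *)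
Lemma adj_coef_zero d (rG : mx_representation algC G d) :
  adj_coef H0 0 0 1%g rG = (d == 1%N)%:R.
Proof.
have M0 : repr_block rG H0 = 0.
  rewrite -(mxblock0 (p_ := fun=> d) (q_ := fun=> d)); apply: eq_mxblock => i j.
  by rewrite /repr_elt big1 // => h _; rewrite scale0r.
have exp0 e h : gmx_exp H0 e 0 0 h = ((e == 0%N) && (h == 1%g))%:R.
  case: e => [|e]; first by rewrite /= /gmx_one eqxx mul1r.
  by rewrite /= /gmx_mul big1 // => j _; rewrite /ga_mul big1 // => x _; rewrite mul0r.
have cp0 e : (char_poly (repr_block rG H0))`_e = (e == (\sum_(i < 1) d)%N)%:R.
  rewrite M0 char_poly_trig ?mx0_is_trig // -coefXn; congr _`_e.
  rewrite (eq_bigr (fun=> 'X)) => [|i _]; first by rewrite prodr_const card_ord.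
  by rewrite mxE subr0.
have tE e : \sum_h gmx_exp H0 e 0 0 h * cfRepr rG (1^-1 * h)%g = ((e == 0%N) * d)%:R.
  rewrite (bigD1 1%g) //= big1 => [|h /negPf nh]; last first.
    by rewrite exp0 nh andbF mul0r.
  by rewrite exp0 eqxx andbT addr0 mulg1 invg1 cfRepr1 natrM.
rewrite /adj_coef.
rewrite (eq_bigr (fun e : 'I_(\sum_(i < 1) d) =>
   (e.+1 == (\sum_(i < 1) d)%N)%:R * ((e == 0%N :> nat) * d)%:R)) => [|e _];
  last by rewrite cp0 tE.
rewrite big_ord1; case: d {rG M0 exp0 cp0 tE} => [|[|d]].
- by rewrite big_ord0 mulr0.
- by rewrite big_ord1 !mul1r -signr_odd mul1r.
rewrite big1 ?mulr0 // => e _; rewrite eqSS.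
by case: eqP => [->|_]; rewrite ?mul0r // mul0n mulr0.
Qed.

Lemma genadj_zero : genadj H0 0 0 1%g = #|(G^`(1))%g|%:R^-1.
Proof.
rewrite genadjE.
have -> : \sum_(k : Iirr G) 'chi_k 1%g * adj_coef H0 0 0 1%g 'Chi_k
    = #|G : G^`(1)|%g%:R.
  rewrite -card_lin_irr -sum1_card natr_sum [RHS]big_mkcond /=.
  apply: eq_bigr => k _; rewrite adj_coef_zero inE qualifE /= irr_char /=.
  by rewrite irr1_degree pnatr_eq1; case: eqP => [->|_]; rewrite ?mulr1 ?mulr0.
rewrite -cardsT -(Lagrange (der_sub 1 G)) natrM invfM divfK //.
by rewrite pnatr_eq0 -lt0n indexg_gt0.
Qed.

End ZeroMatrix.

(** * Integers as central elements, and the denominator ideal *)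

Lemma ga_mul_intl (gT : finGroupType) z (b : grp_elt gT) g :
  ga_mul (@ga_int gT z) b g = z%:~R * b g.
Proof.
rewrite /ga_mul (bigD1 1%g) //= big1 => [|h /negPf nh]; last first.
  by rewrite /ga_int nh mulr0 mul0r.
by rewrite /ga_int eqxx mulr1 addr0 invg1 mul1g.
Qed.

Lemma ga_mul_intr (gT : finGroupType) z (b : grp_elt gT) g :
  ga_mul b (@ga_int gT z) g = z%:~R * b g.
Proof.
rewrite /ga_mul (bigD1 g) //= big1 => [|h nh]; last first.
  by rewrite /ga_int -eq_mulVg1 (negPf nh) !mulr0.
by rewrite /ga_int mulVg eqxx mulr1 addr0 mulrC.
Qed.

(* H(G) ∩ Z = |G'| Z, where G' = [set: gT]^`(1) is the commutator subgroup. *)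
Theorem theoremA (gT : finGroupType) (z : int) :
  denom_ideal (@ga_int gT z) <-> (#|[set: gT]^`(1)%g|%:Z %| z)%Z.
Proof.
split=> [[_ denz] | /dvdzP[q ->]].
  pose H0 : gmx gT 1 := fun _ _ _ => 0.
  have ZH0 : in_MZG H0 by move=> i j g; apply: rpred0.
  have := denz 1%N H0 ZH0 0 0 1%g; rewrite ga_mul_intl genadj_zero.
  case/intrP => q Dq; apply/dvdzP; exists q.
  apply: (@intr_inj algC); rewrite rmorphM /= -Dq.
  by rewrite -pmulrn divfK // pnatr_eq0 -lt0n cardG_gt0.
split.
  split=> [g|b _]; first by rewrite rpredM ?rpred_nat // intr_int.
  by apply: functional_extensionality => g; rewrite ga_mul_intl ga_mul_intr.
move=> n H ZH i j g; rewrite ga_mul_intl rmorphM /= -mulrA -pmulrn.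
by rewrite rpredM ?intr_int // genadj_int.
Qed.
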